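(* Let $m\geq 1$ and $n\geq 1$ be integers. The graph $m\overline{\Gamma(\mathbb{Z}_6)}+n\Gamma(\mathbb{Z}_9)$ (the join of $m\overline{\Gamma(\mathbb{Z}_6)}$ and $n\Gamma(\mathbb{Z}_9)$) admits a distance antimagic labeling if and only if $m=1$.
   Context: For an integer $n \geq 2$, the zero-divisor graph $\Gamma(\mathbb{Z}_n)$ is the simple graph whose vertex set is the set of nonzero zero-divisors of the ring $\mathbb{Z}_n$, two distinct vertices $u,v$ being adjacent iff $uv \equiv 0 \pmod n$. $\overline{H}$ denotes the complement of a graph $H$. For a graph $H$ and positive integer $k$, $kH$ denotes the disjoint union of $k$ copies of $H$. For graphs $G,H$, the join $G+H$ is the graph obtained from the disjoint union of $G$ and $H$ by adding every edge between a vertex of $G$ and a vertex of $H$. A distance antimagic labeling (DAML) of a graph $G$ with $N$ vertices is a bijection $f:V(G)\to\{1,\dots,N\}$ such that the weights $w(v)=\sum_{u\in N(v)} f(u)$, where $N(v)$ is the open neighbourhood of $v$, are pairwise distinct over all vertices $v$. A graph admits DAML if such a labeling exists. *)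

(* Defs.v *)
From HB Require Import structures.
From mathcomp Require Import all_boot all_order all_algebra.

Set Implicit Arguments.
Unset Strict Implicit.
Unset Printing Implicit Defensive.

Import GRing.Theory.

Record sgraph := SGraph {
  vertex :> finType;
  adj : rel vertex;
  adj_sym : symmetric adj;
  adj_irr : irreflexive adj
}.

Section ZeroDivisorGraph.
Variable n : nat.
Local Open Scope ring_scope.

(* For n < 2, 'Z_n is Z/2Z; the graph is Gamma(Z_n) only for n >= 2. *)
Definition nonzero_zero_divisor (x : 'Z_n) : bool :=
  (x != 0) && [exists y : 'Z_n, (y != 0) && (x * y == 0)].

Definition zd_vertex : finType := {x : 'Z_n | nonzero_zero_divisor x}.

Definition zd_adj : rel zd_vertex :=
  fun u v => (u != v) && (val u * val v == 0).

Lemma zd_adj_sym : symmetric zd_adj.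
Proof. by move=> u v; rewrite /zd_adj eq_sym mulrC. Qed.

Lemma zd_adj_irr : irreflexive zd_adj.
Proof. by move=> u; rewrite /zd_adj eqxx. Qed.

Definition zero_divisor_graph : sgraph := SGraph zd_adj_sym zd_adj_irr.

End ZeroDivisorGraph.

Section Complement.
Variable G : sgraph.

Definition compl_adj : rel G := fun u v => (u != v) && ~~ adj u v.

Lemma compl_adj_sym : symmetric compl_adj.
Proof. by move=> u v; rewrite /compl_adj eq_sym adj_sym. Qed.

Lemma compl_adj_irr : irreflexive compl_adj.
Proof. by move=> u; rewrite /compl_adj eqxx. Qed.

Definition complement : sgraph := SGraph compl_adj_sym compl_adj_irr.

End Complement.

Section Copies.
Variables (k : nat) (G : sgraph).

Definition copies_adj : rel ('I_k * G)%type :=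
  fun u v => (u.1 == v.1) && adj u.2 v.2.

Lemma copies_adj_sym : symmetric copies_adj.
Proof. by move=> u v; rewrite /copies_adj eq_sym adj_sym. Qed.

Lemma copies_adj_irr : irreflexive copies_adj.
Proof. by move=> u; rewrite /copies_adj adj_irr andbF. Qed.

Definition copies : sgraph := SGraph copies_adj_sym copies_adj_irr.

End Copies.

Section Join.
Variables G H : sgraph.

Definition join_adj : rel (G + H)%type := fun u v =>
  match u, v with
  | inl x, inl y => adj x y
  | inr x, inr y => adj x y
  | _, _ => true
  end.

Lemma join_adj_sym : symmetric join_adj.
Proof. by case=> x [] y //=; apply: adj_sym. Qed.

Lemma join_adj_irr : irreflexive join_adj.
Proof. by case=> x /=; apply: adj_irr. Qed.

Definition join : sgraph := SGraph join_adj_sym join_adj_irr.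

End Join.

Section DistanceAntimagic.
Variable G : sgraph.

Definition weight (f : G -> nat) (v : G) : nat := \sum_(u : G | adj v u) f u.

Definition bij_onto_1_to_card (f : G -> nat) : Prop :=
  injective f /\ forall k : nat, 0 < k <= #|G| <-> exists v : G, f v = k.

Definition is_DAML (f : G -> nat) : Prop :=
  bij_onto_1_to_card f /\ injective (weight f).

Definition admits_DAML : Prop := exists f : G -> nat, is_DAML f.

End DistanceAntimagic.

(* Main.v *)
Require Import Defs.
From HB Require Import structures.
From mathcomp Require Import all_boot all_order all_algebra.
From mathcomp Require Import zify.

Set Implicit Arguments.
Unset Strict Implicit.
Unset Printing Implicit Defensive.

(** In [m (K_2 + K_1) join n K_2] the [m] isolated vertices of the first side
    have the same neighbourhood, so [m <= 1]. For [m = 1] let [A] and [B] be the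
    label sums of the two sides. The weights are [B], [B + f b], [B + f a] on the
    first side and [A + f y], for [y] in the second side, on the second. If
    [n > 1], the labels 1, 2, 3 on the first side give [A = 6] and [B] larger
    than all [A + f y]; if [n = 1], the labels 3, 4, 5 give [A = 12], [B = 3]
    and the second side has the larger weights. *)

Lemma weight_join_inl (G H : sgraph) (f : join G H -> nat) (x : G) :
  weight f (inl x) =
  weight (fun u => f (inl u)) x + \sum_(y : H) f (inr y).
Proof. by rewrite /weight big_sumType. Qed.

Lemma weight_join_inr (G H : sgraph) (f : join G H -> nat) (y : H) :
  weight f (inr y) =
  \sum_(x : G) f (inl x) + weight (fun u => f (inr u)) y.
Proof. by rewrite /weight big_sumType. Qed.

Lemma weight_copies (k : nat) (G : sgraph) (f : copies k G -> nat) i (x : G) :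
  weight f (i, x) = weight (fun u => f (i, u)) x.
Proof.
transitivity (\sum_(p : 'I_k * G | (i == p.1) && adj x p.2) f (p.1, p.2)).
  by apply: eq_bigr => -[].
rewrite -(pair_big_dep (fun j => i == j) (fun _ u => adj x u)
  (fun j u => f (j, u))) /=.
by rewrite (eq_bigl (pred1 i)) ?big_pred1_eq // => j; rewrite /= eq_sym.
Qed.

(** Pigeonhole: [#|G|] distinct values inside [1..#|G|] exhaust that interval, so only injectivity
    and bounds have to be checked for a labeling. *)
Lemma injective_bij_onto (G : sgraph) (f : G -> nat) :
  injective f -> (forall v, 0 < f v <= #|G|) -> bij_onto_1_to_card f.
Proof.
move=> f_inj f_bound; split=> // k; split=> [|[v <-]]; last exact: f_bound.
have sub : {subset [seq f v | v <- enum G] <= iota 1 #|G|}.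
  by move=> _ /mapP[v _ ->]; rewrite mem_iota add1n ltnS.
have uniq_f : uniq [seq f v | v <- enum G] by rewrite map_inj_uniq ?enum_uniq.
have [|_ eq_f] := uniq_min_size uniq_f sub.
  by rewrite size_iota size_map cardE.
rewrite -(ltnS k) -(add1n #|G|) -mem_iota -eq_f => /mapP[v _ ->].
by exists v.
Qed.

Lemma isolated_copies_join (m : nat) (G H : sgraph) (c : G) :
  @adj G c =1 pred0 -> admits_DAML (join (copies m G) H) -> m <= 1.
Proof.
move=> c_isol [f [_ w_inj]]; rewrite leqNgt; apply/negP=> m_gt1.
have w_c i : weight f (inl (i, c)) = \sum_(y : H) f (inr y).
  rewrite weight_join_inl weight_copies /weight big_pred0 ?add0n //.
(* [ltnW m_gt1] is read as [0 < m]: these are copies 0 and 1 of [c]. *)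
have := w_inj (inl (Ordinal (ltnW m_gt1), c)) (inl (Ordinal m_gt1, c)).
by rewrite !w_c => /(_ erefl).
Qed.

Lemma zd6E (x : 'Z_6) : @nonzero_zero_divisor 6 x = (val x \in [:: 2; 3; 4]).
Proof.
apply/andP/idP => [[x_neq0 /existsP[y /andP[]]]|].
  by case: x x_neq0 y => [[|[|[|[|[|[|]]]]]] ?] //= _ [[|[|[|[|[|[|]]]]]] ?].
case: x => [[|[|[|[|[|[|]]]]]] lt_x] //= _; split=> //; apply/existsP;
  (* The residue 3 annihilates 2 and 4, and 2 annihilates 3. *)
  by [exists (@inZp 5 3) | exists (@inZp 5 2)].
Qed.

Lemma zd9E (x : 'Z_9) : @nonzero_zero_divisor 9 x = (val x \in [:: 3; 6]).
Proof.
apply/andP/idP => [[x_neq0 /existsP[y /andP[]]]|].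
  by case: x x_neq0 y => [[|[|[|[|[|[|[|[|[|]]]]]]]]] ?] //= _
    [[|[|[|[|[|[|[|[|[|]]]]]]]]] ?].
case: x => [[|[|[|[|[|[|[|[|[|]]]]]]]]] lt_x] //= _; split=> //; apply/existsP;
  by exists (@inZp 8 3).
Qed.

(** With vertices read as naturals, adjacency tests and labels become closed computations once the
    sums are enumerated. *)
Definition zd_nat (n : nat) (u : zd_vertex n) : nat := val u.

Lemma zd_nat_inj (n : nat) : injective (@zd_nat n).
Proof. by move=> u v /val_inj/val_inj. Qed.

Lemma sum_zd6 (Q : pred nat) (F : nat -> nat) :
  \sum_(u : zd_vertex 6 | Q (zd_nat u)) F (zd_nat u) =
  (if Q 2 then F 2 else 0) + (if Q 3 then F 3 else 0) + (if Q 4 then F 4 else 0).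
Proof.
rewrite /zd_nat -(big_sub_cond (@nonzero_zero_divisor 6) (fun x => Q x) (fun x => F x)).
rewrite (eq_bigl _ _ (fun x : 'Z_6 => congr1 (andb^~ (Q x)) (zd6E x))) big_mkcond.
by rewrite !big_ord_recl big_ord0 /= !add0n !addn0 addnA.
Qed.

Lemma sum_zd9 (Q : pred nat) (F : nat -> nat) :
  \sum_(u : zd_vertex 9 | Q (zd_nat u)) F (zd_nat u) =
  (if Q 3 then F 3 else 0) + (if Q 6 then F 6 else 0).
Proof.
rewrite /zd_nat -(big_sub_cond (@nonzero_zero_divisor 9) (fun x => Q x) (fun x => F x)).
rewrite (eq_bigl _ _ (fun x : 'Z_9 => congr1 (andb^~ (Q x)) (zd9E x))) big_mkcond.
by rewrite !big_ord_recl big_ord0 /= !add0n !addn0.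
Qed.

Lemma zd6_val (u : zd_vertex 6) : zd_nat u \in [:: 2; 3; 4].
Proof. by case: u => x /= Px; rewrite -zd6E. Qed.

Lemma zd9_val (u : zd_vertex 9) : zd_nat u \in [:: 3; 6].
Proof. by case: u => x /= Px; rewrite -zd9E. Qed.

(** The graph of ['Z_6] is the path 2 - 3 - 4; its complement has the single edge 2 - 4, whose ends
    sum to 6, and 3 is isolated. *)
Lemma weight_compl_zd6 (F : nat -> nat) (v : zd_vertex 6) :
  weight (G := complement (zero_divisor_graph 6)) (fun u => F (zd_nat u)) v =
  if zd_nat v == 3 then 0 else F (6 - zd_nat v).
Proof.
(* [Q] is convertible to adjacency in the complement, with the product taken in [nat] modulo 6. *)
pose Q (k : nat) :=
  (zd_nat v != k) && ~~ ((zd_nat v != k) && ((zd_nat v * k) %% 6 == 0)).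
transitivity (\sum_(u : zd_vertex 6 | Q (zd_nat u)) F (zd_nat u)).
  exact: eq_bigl.
rewrite sum_zd6 /Q.
have := zd6_val v.
by rewrite !inE => /or3P[]/eqP->; rewrite /= ?addn0.
Qed.

(** The only edge is 3 - 6, and its ends sum to 9. *)
Lemma weight_zd9 (F : nat -> nat) (v : zd_vertex 9) :
  weight (G := zero_divisor_graph 9) (fun u => F (zd_nat u)) v = F (9 - zd_nat v).
Proof.
pose Q (k : nat) := (zd_nat v != k) && ((zd_nat v * k) %% 9 == 0).
transitivity (\sum_(u : zd_vertex 9 | Q (zd_nat u)) F (zd_nat u)).
  exact: eq_bigl.
rewrite sum_zd9 /Q.
have := zd9_val v.
by rewrite !inE => /orP[]/eqP->; rewrite /= ?addn0.
Qed.

Lemma card_zd6 : #|zd_vertex 6| = 3.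
Proof. by rewrite -sum1_card (sum_zd6 predT (fun=> 1)). Qed.

Lemma card_zd9 : #|zd_vertex 9| = 2.
Proof. by rewrite -sum1_card (sum_zd9 predT (fun=> 1)). Qed.

Lemma compl_zd6_isolated :
  exists c : complement (zero_divisor_graph 6), adj c =1 pred0.
Proof.
have P3 : @nonzero_zero_divisor 6 (@inZp 5 3) by rewrite zd6E.
exists (Sub _ P3) => u.
rewrite -[LHS]/((3 != zd_nat u) &&
  ~~ ((3 != zd_nat u) && ((3 * zd_nat u) %% 6 == 0))).
have := zd6_val u.
by rewrite !inE => /or3P[]/eqP->.
Qed.

Section Labels.

(* Used with [(d, e) = (1, 4)] for [n > 1] and with [(d, e) = (3, 1)] for [n = 1]. *)
Variables (n d e : nat).

(** The first side gets the block [d..d+2], the second the block [e..e+2n-1], each copy of [K_2]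
    taking two consecutive labels. *)
Definition shifted_label
    (x : join (copies 1 (complement (zero_divisor_graph 6)))
              (copies n (zero_divisor_graph 9))) : nat :=
  match x with
  | inl (_, u) => zd_nat u - 2 + d
  | inr (j, v) => 2 * j + (zd_nat v == 6) + e
  end.

Lemma sum_label_inl : \sum_x shifted_label (inl x) = 3 * d + 3.
Proof.
transitivity (\sum_(p : 'I_1 * _) shifted_label (inl (p.1, p.2))).
  by apply: eq_bigr => -[].
rewrite -(pair_big predT predT (fun i u => shifted_label (inl (i, u)))) /=.
by rewrite big_ord1 (sum_zd6 predT (fun k => k - 2 + d)) /=; lia.
Qed.

Lemma sum_label_inr : \sum_y shifted_label (inr y) = n * (2 * n + 2 * e - 1).
Proof.
transitivity (\sum_(p : 'I_n * _) shifted_label (inr (p.1, p.2))).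
  by apply: eq_bigr => -[].
rewrite -(pair_big predT predT (fun i u => shifted_label (inr (i, u)))) /=.
under eq_bigr => j _ do
  rewrite (sum_zd9 predT (fun k => 2 * j + (k == 6) + e)) /=.
elim: n => [|k IHk]; first by rewrite big_ord0.
(* In the induction hypothesis the subtraction can truncate only at [k = 0], where the factor [k]
   vanishes; the case split isolates this. *)
by rewrite big_ord_recr /= IHk; case: k {IHk} => [|k]; nia.
Qed.

Lemma weight_label_inl i u :
  weight shifted_label (inl (i, u)) =
  (if zd_nat u == 3 then 0 else 6 - zd_nat u - 2 + d) + n * (2 * n + 2 * e - 1).
Proof.
by rewrite weight_join_inl weight_copies sum_label_inr
  (weight_compl_zd6 (fun k => k - 2 + d)).
Qed.

Lemma weight_label_inr j v :
  weight shifted_label (inr (j, v)) =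
  3 * d + 3 + (2 * j + (9 - zd_nat v == 6) + e).
Proof.
by rewrite weight_join_inr weight_copies sum_label_inl
  (weight_zd9 (fun k => 2 * j + (k == 6) + e)).
Qed.

(** The first three hypotheses put the two label blocks inside [1..2n+3] and make them disjoint.
    With [B] the second label sum, the first side has weights [B], [B+d], [B+d+2] and the second
    fills [3d+3+e..3d+2+e+2n]; the last hypothesis places one range wholly below the other. *)
Lemma shifted_label_DAML :
  0 < d <= 2 * n + 1 -> 0 < e <= 4 -> (d + 3 <= e) || (e + 2 * n <= d) ->
  (n * (2 * n + 2 * e - 1) + d + 2 < 3 * d + 3 + e) ||
  (3 * d + 3 + 2 * n + e <= n * (2 * n + 2 * e - 1)) ->
  is_DAML shifted_label.
Proof.
(* Naming the quadratic term keeps the later goals linear in [B]. *)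
move=> d_bound e_bound disj; set B := n * _ => weights_apart.
have zd6_eq (i j : 'I_1) (u v : zd_vertex 6) :
    zd_nat u = zd_nat v -> (i, u) = (j, v).
  by rewrite (ord1 i) (ord1 j) => /zd_nat_inj->.
have zd9_eq (i j : 'I_n) (u v : zd_vertex 9) :
    i = j :> nat -> zd_nat u = zd_nat v -> (i, u) = (j, v).
  by move=> /val_inj-> /zd_nat_inj->.
split; [apply: injective_bij_onto|].
- case=> [[i u]|[i u]] [[j v]|[j v]] /=.
  + have := zd6_val u; have := zd6_val v; rewrite !inE => u_val v_val eq_uv.
    by congr inl; apply: zd6_eq; lia.
  + have := zd6_val u; have := ltn_ord j; rewrite !inE; lia.
  + have := zd6_val v; have := ltn_ord i; rewrite !inE; lia.
  + have := zd9_val u; have := zd9_val v; rewrite !inE => u_val v_val eq_uv.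
    by congr inr; apply: zd9_eq; lia.
- rewrite card_sum !card_prod !card_ord card_zd6 card_zd9.
  case=> [[i u]|[i u]] /=.
  + have := zd6_val u; rewrite !inE; lia.
  + have := zd9_val u; have := ltn_ord i; rewrite !inE; lia.
- case=> [[i u]|[i u]] [[j v]|[j v]];
    rewrite ?weight_label_inl ?weight_label_inr -/B.
  + have := zd6_val u; have := zd6_val v; rewrite !inE => u_val v_val eq_uv.
    by congr inl; apply: zd6_eq; move: eq_uv; do 2![case: ifP]; lia.
  + have := zd6_val u; have := ltn_ord j; rewrite !inE; case: ifP; lia.
  + have := zd6_val v; have := ltn_ord i; rewrite !inE; case: ifP; lia.
  + have := zd9_val u; have := zd9_val v; rewrite !inE => u_val v_val eq_uv.
    by congr inr; apply: zd9_eq; lia.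
Qed.

End Labels.

Theorem theorem2p8 (m n : nat) (hm : 1 <= m) (hn : 1 <= n) :
  admits_DAML (join (copies m (complement (zero_divisor_graph 6)))
                    (copies n (zero_divisor_graph 9)))
  <-> m = 1.
Proof.
have [c c_isol] := compl_zd6_isolated.
split=> [/(isolated_copies_join c_isol) m_le1 | ->].
  by apply/eqP; rewrite eqn_leq m_le1.
(* For [(d, e) = (1, 4)] the weights separate when [2n+10 <= n(2n+7)], which holds from [n = 2] on
   but not at [n = 1]; there [(3, 1)] gives [8 < 13]. *)
have [n_gt1|n_le1] := ltnP 1 n.
  by exists (@shifted_label n 1 4); apply: shifted_label_DAML; nia.
by exists (@shifted_label n 3 1); apply: shifted_label_DAML; nia.
Qed.
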